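(* Let $p(x) \in \mathbb{R}[x]$ be a real-rooted polynomial of degree $n \geq 2$ with positive leading coefficient, and let $\mu_1 \leq \mu_2 \leq \dots \leq \mu_n$ be its roots (with multiplicity). Let $P(x) = \int_0^x p(y)\,dy$. Let $h_1 \leq \dots \leq h_n$ be real numbers such that the multisets $\{h_1, \dots, h_n\}$ and $\{-P(\mu_1), \dots, -P(\mu_n)\}$ are equal. Let $k = \lfloor n/2 \rfloor$ and let $h$ be a real number with $h_k \leq h \leq h_{k+1}$. Suppose that $P(x)+h$ is real-rooted, and let $C$ be a real number. Then $P(x)+C$ is real-rooted if and only if $h_k \leq C \leq h_{k+1}$.
   Context: A nonzero polynomial in $\mathbb{R}[x]$ is called real-rooted if all of its complex roots are real. *)

(* Defs.v *)
From HB Require Import structures.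
From mathcomp Require Import all_boot all_order all_algebra.
From mathcomp Require Import complex.
From mathcomp Require Import reals.
Set Implicit Arguments. Unset Strict Implicit. Unset Printing Implicit Defensive.
Import Order.TTheory GRing.Theory Num.Theory.
Local Open Scope ring_scope.
Local Open Scope complex_scope.

Definition real_rooted (R : realType) (p : {poly R}) : Prop :=
  p != 0 /\
  forall z : R[i], root (map_poly (fun x : R => x%:C) p) z -> Im z = 0.

Definition prim (R : realType) (p : {poly R}) : {poly R} :=
  \poly_(i < (size p).+1) (if i is j.+1 then p`_j / j.+1%:R else 0).

(* Main.v *)
(* Let mu_1 <= ... <= mu_n be the roots of p = Q', with Q of positive leading
   coefficient. Then Q is real-rooted iff (-1)^(n+1-i) Q(mu_i) >= 0 for all i.
   If Q is real-rooted, Rolle's theorem, with multiplicities, interlaces the mu_i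
   with the roots of Q, which gives the signs. Conversely the signs give a root of Q
   in each of the n+1 closed intervals cut out by the mu_i; a point chosen c times
   is a root of Q and a root of Q' of multiplicity at least c-1, hence a root of Q
   of multiplicity at least c, so these n+1 points are all the roots.
   For Q = P + C the conditions say that floor(n/2) of the values -P(mu_i) are
   <= C and the remaining ones are >= C. As one such h exists, the former are
   h_1, ..., h_k and the latter h_(k+1), ..., h_n. *)
Require Import Defs.
From HB Require Import structures.
From mathcomp Require Import all_boot all_order all_algebra.
From mathcomp Require Import complex polyorder polyrcf.
From mathcomp Require Import reals.
Import Order.TTheory GRing.Theory Num.Theory.
Local Open Scope ring_scope.

(** * Roots forced by alternating signs *)

(* Signs are normalised at the right end: [Q] is nonpositive at the last point
   of [s], as it is at the largest critical point of a real-rooted polynomial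
   with positive leading coefficient. *)
Definition alternates {R : rcfType} (Q : {poly R}) (s : seq R) : Prop :=
  forall i, (i < size s)%N -> 0 <= (-1) ^+ (size s - i) * Q.[s`_i].

Lemma alternates_cons {R : rcfType} (Q : {poly R}) (a : R) (s : seq R) :
  alternates Q (a :: s) <->
  0 <= (-1) ^+ (size s).+1 * Q.[a] /\ alternates Q s.
Proof.
split=> [alt_as|[Qa alt_s] [|i]]; last exact: (alt_s i).
  by split=> [|i lt_is]; [apply: (alt_as 0%N) | apply: (alt_as i.+1)].
by rewrite subn0.
Qed.

Lemma alternating_root {R : rcfType} (Q : {poly R}) (a b : R) (k : nat) :
    a <= b -> 0 <= (-1) ^+ k.+1 * Q.[a] -> 0 <= (-1) ^+ k * Q.[b] ->
  exists2 x, a <= x <= b & root Q x.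
Proof.
move=> le_ab Qa Qb; have sgn_neq0 : (-1) ^+ k != 0 :> R by rewrite signr_eq0.
have [|x ab_x] := @poly_ivt R ((-1) ^+ k *: Q) a b le_ab.
  by move: Qa; rewrite exprS mulN1r mulNr oppr_ge0 !hornerZ Qb andbT.
by rewrite rootZ // => Qx; exists x.
Qed.

(** Induction from the right: each interval between consecutive points holds a root, and so does the
    ray beyond the last point, where [Q] goes from a nonpositive to a positive value. Roots chosen
    in neighbouring intervals coincide only at the common endpoint, whence the count. *)
Lemma interlacing_roots {R : rcfType} (Q : {poly R}) (a : R) (s : seq R) :
    0 < lead_coef Q -> path <=%R a s -> alternates Q (a :: s) ->
  exists nu, [/\ size nu = (size s).+1, all (root Q) nu, all (>= a) nu
               & forall x, (count_mem x nu <= (count_mem x s).+1)%N].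
Proof.
move=> lcQ; elim: s a => [|b s IHs] a /= => [_|/andP[le_ab path_bs]].
  case/alternates_cons=> Qa _; have [M QM] := poly_pinfty_gt_lc lcQ.
  have [||x /andP[le_ax _] Qx] := alternating_root Q a (Num.max a M) 0 _ Qa.
  - by rewrite le_max lexx.
  - by rewrite mul1r (le_trans (ltW lcQ)) // QM // le_max lexx orbT.
  exists [:: x]; split=> //= [||y]; rewrite ?Qx ?le_ax //.
  by rewrite !addn0 leq_b1.
case/alternates_cons=> Qa alt_bs; have /alternates_cons[Qb _] := alt_bs.
have [x /andP[le_ax le_xb] Qx] := alternating_root _ _ _ _ le_ab Qa Qb.
have [nu [sz_nu Qnu ge_nu cnt_nu]] := IHs b path_bs alt_bs.
exists (x :: nu); split=> /= [|||y]; first by rewrite sz_nu.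
- by rewrite Qx.
- by rewrite le_ax; apply: sub_all ge_nu => z; apply: le_trans.
have [<-{y}|_] := eqVneq x y; last first.
  by rewrite add0n (leq_trans (cnt_nu y)) // ltnS leq_addl.
(* A further copy of [x] in [nu] forces [x = b], since all of [nu] is at least [b]. *)
have [_|neq_bx] := eqVneq b x; first by rewrite ltnS cnt_nu.
rewrite add0n (_ : count_mem x nu = 0)%N //; apply/count_memPn.
apply: contra neq_bx => /(allP ge_nu) le_bx.
by rewrite eq_le le_bx le_xb.
Qed.

(** * Rolle's theorem with multiplicities *)

(* The counting clause bounds the multiplicity in [mu] by the one in [Q^`()]:
   a root of [Q] loses one in the derivative, a point strictly between two
   roots is used once. *)
Lemma rolle_seq {R : rcfType} (Q : {poly R}) (a : R) (s : seq R) :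
    path <=%R a s -> all (root Q) (a :: s) ->
  exists mu, [/\ size mu = size s, path <=%R a mu,
      alternates (\prod_(m <- a :: s) ('X - m%:P)) mu
    & forall x, (count_mem x mu <= (count_mem x (a :: s)).-1
                 + ((x \notin a :: s) && root Q^`() x))%N].
Proof.
elim: s a => [|b s IHs] a; first by exists [::].
move=> /= /andP[le_ab path_bs] /and3P[Qa Qb Qs].
have [|mu [sz_mu path_mu alt_mu cnt_mu]] := IHs b path_bs; first by rewrite /= Qb.
have ge_s : all (>= b) s by apply: order_path_min path_bs; apply: le_trans.
have ge_mu : all (>= b) mu by apply: order_path_min path_mu; apply: le_trans.
(* Any [c] in [[a, b]] keeps the signs: the factor of [a] is nonnegative at [c] and on [mu], the
   other factors are nonpositive at [c]. *)
have alt_cons c : a <= c <= b ->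
  alternates (\prod_(m <- [:: a, b & s]) ('X - m%:P)) (c :: mu).
  move=> /andP[le_ac le_cb]; apply/alternates_cons; split.
    rewrite big_cons hornerM hornerXsubC mulrCA mulr_ge0 ?subr_ge0 //.
    rewrite sz_mu -[(size s).+1]/(size (b :: s)) horner_prod.
    have: all (>= c) (b :: s).
      by rewrite /= le_cb; apply: sub_all ge_s => z; apply: le_trans.
    elim: (b :: s) => [|d t IHt] /=; first by rewrite big_nil mul1r.
    move=> /andP[le_cd /IHt t_ge0]; rewrite big_cons exprS hornerXsubC mulrACA.
    by rewrite mulN1r opprB mulr_ge0 ?subr_ge0.
  move=> i lt_i; rewrite big_cons hornerM hornerXsubC mulrCA mulr_ge0 ?alt_mu //.
  rewrite subr_ge0 (le_trans le_ac) // (le_trans le_cb) //.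
  exact/(allP ge_mu)/mem_nth.
have path_cons c : a <= c <= b -> path <=%R a (c :: mu).
  case/andP=> le_ac le_cb; rewrite /= le_ac path_min_sorted ?(path_sorted path_mu) //.
  by apply: sub_all ge_mu => z; apply: le_trans.
(* A repeated root serves as its own critical point; otherwise Rolle's theorem gives one strictly
   inside. *)
have [eq_ab|neq_ab] := eqVneq a b.
  exists (a :: mu); split=> [|||x]; first by rewrite /= sz_mu.
  - by rewrite path_cons ?lexx.
  - by apply: alt_cons; rewrite lexx.
  move: (cnt_mu x); rewrite -eq_ab /= !inE.
  case: eqVneq => [<-|_]; rewrite ?eqxx /= ?addn0 ?add0n //.
have lt_ab : a < b by rewrite lt_neqAle neq_ab.
have [|c] := @poly_rolle R a b Q lt_ab; first by rewrite (rootP Qa) (rootP Qb).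
rewrite in_itv /= => /andP[lt_ac lt_cb] /rootP Q'c.
exists (c :: mu); split=> [|||x]; first by rewrite /= sz_mu.
- by rewrite path_cons ?ltW.
- by apply: alt_cons; rewrite !ltW.
move: (cnt_mu x) => /=; rewrite !inE !negb_or [x == a]eq_sym.
have notin y : y < b -> (count_mem y mu = 0)%N.
  move=> lt_yb; apply/count_memPn; apply/negP => /(allP ge_mu) /=.
  by rewrite leNgt lt_yb.
have [<- _|neq_ax] := eqVneq a x.
  by rewrite gt_eqF //= notin.
have [<- _|neq_cx] := eqVneq c x; last by rewrite !add0n.
rewrite notin // [c == b]lt_eqF //= Q'c.
suff -> : c \notin s by rewrite addn1.
by apply/negP => /(allP ge_s) /=; rewrite leNgt lt_cb.
Qed.

(** * Multiplicities and the sign criterion *)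

Lemma prod_XsubC_dvdp {R : rcfType} (p : {poly R}) (s : seq R) :
    p != 0 -> (forall x, (count_mem x s <= \mu_x p)%N) ->
  \prod_(a <- s) ('X - a%:P) %| p.
Proof.
elim: s p => [|a s IHs] p p_neq0 cnt_s; first by rewrite big_nil dvd1p.
have /factor_theorem[q Dp] : root p a.
  by rewrite -mu_gt0 // (leq_trans _ (cnt_s a)) //= eqxx.
rewrite big_cons Dp mulrC dvdp_mul2r ?polyXsubC_eq0 //.
have q_neq0 : q != 0 by apply: contraNneq p_neq0 => q0; rewrite Dp q0 mul0r.
apply: IHs => // x; move: (cnt_s x); rewrite Dp mu_mul -?Dp //= addnC.
have [->|neq_ax] := eqVneq a x; first by rewrite mu_XsubC leq_add2r.
by rewrite [\mu_x ('X - _)]muNroot ?root_XsubC 1?eq_sym // !addn0.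
Qed.

Lemma dvdp_prod_XsubC_eq {R : rcfType} (p : {poly R}) (s : seq R) :
    size p = (size s).+1 -> \prod_(a <- s) ('X - a%:P) %| p ->
  p = lead_coef p *: \prod_(a <- s) ('X - a%:P).
Proof.
move=> sz_p dvd_p.
have /eqp_eq : \prod_(a <- s) ('X - a%:P) %= p.
  by rewrite -dvdp_size_eqp // size_prod_XsubC sz_p.
by rewrite lead_coef_prod_XsubC scale1r.
Qed.

(** The behaviour at plus infinity, applied to [(-1)^d Q(-x)] with [d] the degree of [Q]; this
    reflection keeps the leading coefficient. *)
Lemma poly_minfty_sign {R : rcfType} (Q : {poly R}) :
    0 < lead_coef Q ->
  exists M, forall x, x <= M -> 0 <= (-1) ^+ (size Q).-1 * Q.[x].
Proof.
move=> lcQ; pose T := (-1) ^+ (size Q).-1 *: (Q \Po (- 'X)).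
have lcT : lead_coef T = lead_coef Q.
  rewrite /T lead_coefZ lead_coef_comp ?size_polyN ?size_polyX //.
  by rewrite lead_coefN lead_coefX mulrCA -expr2 sqrr_sign mulr1.
have [|M TM] := @poly_pinfty_gt_lc R T; first by rewrite lcT.
exists (- M) => x le_xM; have := TM (- x); rewrite lerNr lcT => /(_ le_xM).
by rewrite hornerZ horner_comp !hornerE opprK; apply/le_trans/ltW.
Qed.

Lemma alternates_split {R : rcfType} (Q : {poly R}) (s : seq R) :
    sorted <=%R s -> 0 < lead_coef Q -> size Q = (size s).+2 ->
    Q^`() = lead_coef Q^`() *: \prod_(m <- s) ('X - m%:P) ->
    alternates Q s ->
  exists nu, Q = lead_coef Q *: \prod_(m <- nu) ('X - m%:P).
Proof.
move=> sorted_s lcQ sz_Q DQ' alt_s.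
have Q_neq0 : Q != 0 by rewrite -lead_coef_eq0 gt_eqF.
have Q'_neq0 : Q^`() != 0 by rewrite -size_poly_eq0 size_deriv sz_Q.
(* The point [a] lies below all of [s], or at its head, and far enough left for [Q] to have its sign
   at minus infinity. It supplies the leftmost interval, so that the roots found are as many as the
   degree of [Q]. *)
have [M QM] := poly_minfty_sign Q lcQ; pose a := Num.min M (head 0 s).
have path_as : path <=%R a s.
  by move: sorted_s; rewrite /a; case: (s) => //= b t ->; rewrite ge_min lexx orbT.
have alt_as : alternates Q (a :: s).
  apply/alternates_cons; split=> //.
  by rewrite -[(size s).+1]/(size s).+2.-1 -sz_Q QM // ge_min lexx.
have [nu [sz_nu Qnu _ cnt_nu]] := interlacing_roots Q a s lcQ path_as alt_as.
exists nu; apply: dvdp_prod_XsubC_eq; first by rewrite sz_nu.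
apply: prod_XsubC_dvdp => // x; have [nu_x|/count_memPn-> //] := boolP (x \in nu).
have Qx : root Q x by apply: (allP Qnu).
apply: leq_trans (cnt_nu x) _.
have -> : count_mem x s = \mu_x Q^`().
  rewrite DQ' mu_mulC ?lead_coef_eq0 //; elim: (s) => [|b t IHt].
    by rewrite big_nil mu_polyC.
  rewrite big_cons mu_mul /=; last first.
    by rewrite mulf_neq0 ?polyXsubC_eq0 // monic_neq0 ?monic_prod_XsubC.
  rewrite IHt; congr (_ + _)%N; have [->|neq_bx] := eqVneq b x; first by rewrite mu_XsubC.
  by rewrite muNroot ?root_XsubC 1?eq_sym.
by rewrite mu_deriv // subn1 prednK // mu_gt0.
Qed.

Lemma split_alternates {R : rcfType} (Q : {poly R}) (nu s : seq R) :
    sorted <=%R s -> 0 < lead_coef Q -> size Q = (size s).+2 ->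
    Q^`() = lead_coef Q^`() *: \prod_(m <- s) ('X - m%:P) ->
    Q = lead_coef Q *: \prod_(m <- nu) ('X - m%:P) ->
  alternates Q s.
Proof.
move=> sorted_s lcQ sz_Q DQ' DQ.
have Q_neq0 : Q != 0 by rewrite -lead_coef_eq0 gt_eqF.
have Q'_neq0 : Q^`() != 0 by rewrite -size_poly_eq0 size_deriv sz_Q.
have perm_nu : perm_eq (sort <=%R nu) nu by rewrite perm_sort.
rewrite -(perm_big _ perm_nu) /= in DQ.
have := sort_le_sorted nu; case Dnu: (sort _ _) DQ => [|a t] DQ /= path_at.
  by move: sz_Q; rewrite DQ big_nil size_scale ?lead_coef_eq0 // size_poly1.
have root_nu : all (root Q) (a :: t).
  by apply/allP => x x_nu; rewrite DQ rootZ ?lead_coef_eq0 // root_prod_XsubC.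
have [mu [sz_mu path_mu alt_mu cnt_mu]] := rolle_seq Q a t path_at root_nu.
have sz_t : size t = size s.
  move: sz_Q; rewrite DQ size_scale ?lead_coef_eq0 // size_prod_XsubC.
  by case.
(* The Rolle points are roots of the derivative, counted within its multiplicities, and as many as
   its degree: they are all its roots. *)
have Ds : s = mu.
  apply: le_sorted_eq => //; first exact: path_sorted path_mu.
  apply: prod_XsubC_eq; apply: (scalerI (a := lead_coef Q^`())).
    by rewrite lead_coef_eq0.
  rewrite -DQ'; apply: dvdp_prod_XsubC_eq; first by rewrite size_deriv sz_Q sz_mu sz_t.
  apply: prod_XsubC_dvdp => // x; apply: leq_trans (cnt_mu x) _.
  have [at_x|at_x] /= := boolP (x \in a :: t); last first.
    have /count_memPn /= -> := at_x.
    by rewrite add0n; case Q'x: (root _ x); rewrite // mu_gt0.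
  rewrite addn0 mu_deriv ?(allP root_nu) // -subn1 leq_sub2r //.
  rewrite -root_le_mu // DQ dvdpZr ?lead_coef_eq0 // (bigID (pred1 x)) /=.
  rewrite dvdp_mulr // (eq_bigr (fun=> 'X - x%:P)) => [|m /eqP-> //].
  by rewrite big_const_seq iter_mulr_1 /= dvdpp.
move=> i lt_i; rewrite DQ hornerZ mulrCA mulr_ge0 ?(ltW lcQ) // Ds alt_mu //.
by rewrite -Ds.
Qed.

(** * Real-rootedness and primitives *)

(** The polynomial splits over [R[i]]; when its roots are real, this factorisation descends along
    the injective embedding of [R]. *)
Lemma real_rooted_split {R : realType} (p : {poly R}) :
  real_rooted p <->
  p != 0 /\ exists s, p = lead_coef p *: \prod_(m <- s) ('X - m%:P).
Proof.
have map_prod (s : seq R) : map_poly (real_complex R) (\prod_(m <- s) ('X - m%:P))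
    = \prod_(z <- map (real_complex R) s) ('X - z%:P).
  by rewrite rmorph_prod big_map; apply: eq_bigr => m _; rewrite /= map_polyXsubC.
split=> [] [p_neq0 rootsP]; split=> //; last first.
  move=> z; have [s Dp] := rootsP; rewrite -[map_poly _ p]/(map_poly (real_complex R) p).
  rewrite Dp map_polyZ map_prod rootZ ?fmorph_eq0 ?lead_coef_eq0 //.
  by rewrite root_prod_XsubC => /mapP[x _ ->]; rewrite -complexIm.
have [zs Dp] := closed_field_poly_normal (map_poly (real_complex R) p).
exists [seq complex.Re z | z <- zs]; apply: (map_poly_inj (real_complex R)).
rewrite map_polyZ /= map_prod {1}Dp lead_coef_map -map_comp map_id_in //.
move=> z z_zs; have /rootsP : root (map_poly (real_complex R) p) z.
  by rewrite Dp rootZ ?lead_coef_eq0 ?map_poly_eq0 // root_prod_XsubC.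
by rewrite -complexIm; case: z {z_zs} => x y /= [->].
Qed.

Lemma deriv_prim {R : realType} (p : {poly R}) : (prim p)^`() = p.
Proof.
apply/polyP => i; rewrite coef_deriv coef_poly ltnS.
case: ltnP => [_|le_i]; last by rewrite mul0rn nth_default.
by rewrite -[LHS]mulr_natr mulfVK // pnatr_eq0.
Qed.

Lemma size_prim {R : realType} (p : {poly R}) :
  p != 0 -> size (prim p) = (size p).+1.
Proof.
move=> p_neq0; apply: size_poly_eq.
rewrite -[size p]prednK ?size_poly_gt0 //= mulf_neq0 //.
  by rewrite -lead_coefE lead_coef_eq0.
by rewrite invr_eq0 pnatr_eq0.
Qed.

Lemma lead_coef_prim {R : realType} (p : {poly R}) :
  p != 0 -> lead_coef (prim p) = lead_coef p / (size p)%:R.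
Proof.
move=> p_neq0; rewrite lead_coefE size_prim // coef_poly /= leqnn.
by rewrite -[size p]prednK ?size_poly_gt0.
Qed.

(** The derivative is [p] whatever [C] is, so one list of critical points tests all constants. *)
Lemma real_rooted_prim {R : realType} (p : {poly R}) (s : seq R) (C : R) :
    p != 0 -> 0 < lead_coef p -> sorted <=%R s ->
    p = lead_coef p *: \prod_(m <- s) ('X - m%:P) ->
  real_rooted (prim p + C%:P) <-> alternates (prim p + C%:P) s.
Proof.
move=> p_neq0 lcp sorted_s Dp.
have sz_p : size p = (size s).+1.
  by rewrite Dp size_scale ?lead_coef_eq0 // size_prod_XsubC.
have lt_C : (size C%:P < size (prim p))%N.
  by rewrite size_prim // sz_p (leq_ltn_trans (size_polyC_leq1 C)).
have sz_Q : size (prim p + C%:P) = (size s).+2.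
  by rewrite size_polyDl // size_prim // sz_p.
have DQ' : (prim p + C%:P)^`() = p by rewrite derivD derivC addr0 deriv_prim.
have lcQ : 0 < lead_coef (prim p + C%:P).
  by rewrite lead_coefDl // lead_coef_prim // divr_gt0 // ltr0n sz_p.
rewrite -DQ' in Dp; apply: (iff_trans (real_rooted_split _)); split.
  by case=> _ [nu DQ]; apply: split_alternates DQ.
move=> alt_s; split; first by rewrite -lead_coef_eq0 gt_eqF.
exact: alternates_split alt_s.
Qed.

(** * Comparison of the constant with the two middle values *)

(** At [m = 0] this counts the indices with sign [+1] in [alternates]; the offset [m] serves the
    induction. *)
Lemma count_iota_even_sub (m n : nat) :
  count (fun i => ~~ odd (m + n - i)) (iota m n) = n./2.
Proof.
elim: n m => //= n IHn m; rewrite addKn -addSnnS IHn /= negbK.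
by rewrite uphalf_half.
Qed.

(** Only the maximum of [s] matters, the last entry once sorted. The lookup is in a concatenation
    because the sorted values will be split into two blocks. *)
Lemma all_le_sort_nth {R : realDomainType} (s t : seq R) (C : R) :
  (0 < size s)%N -> all (<= C) s = ((sort <=%R s ++ t)`_(size s).-1 <= C).
Proof.
move=> s_gt0; rewrite nth_cat size_sort prednK // leqnn.
apply/allP/idP => [leC|leC x x_s].
  by apply: leC; rewrite -(mem_sort <=%R) mem_nth // size_sort prednK.
have /(nthP 0)[j] : x \in sort <=%R s by rewrite mem_sort.
rewrite size_sort => lt_j <-.
apply: le_trans leC; apply: sorted_leq_nth; rewrite ?sort_le_sorted ?inE ?size_sort //.
- exact: le_trans.
- by rewrite prednK.
- by rewrite -ltnS prednK.
Qed.

Lemma all_ge_sort_nth {R : realDomainType} (s t : seq R) (C : R) :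
  (0 < size s)%N -> all (>= C) s = (C <= (t ++ sort <=%R s)`_(size t)).
Proof.
move=> s_gt0; rewrite nth_cat ltnn subnn.
apply/allP/idP => [geC|geC x x_s].
  by apply: geC; rewrite -(mem_sort <=%R) mem_nth // size_sort.
have /(nthP 0)[j] : x \in sort <=%R s by rewrite mem_sort.
rewrite size_sort => lt_j <-.
apply: le_trans geC _; apply: sorted_leq_nth; rewrite ?sort_le_sorted ?inE ?size_sort //.
exact: le_trans.
Qed.

(* The condition at [h] forces the [n./2] values bounding the constant from
   below to be the smallest ones, so that every other constant is compared with
   the same two middle values. *)
Lemma alternates_sorted_values {R : realType} (P : {poly R}) (s hs : seq R) (h C : R) :
    (2 <= size s)%N -> sorted <=%R hs -> perm_eq hs [seq - P.[m] | m <- s] ->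
    alternates (P + h%:P) s ->
  alternates (P + C%:P) s <-> hs`_(size s)./2.-1 <= C <= hs`_(size s)./2.
Proof.
set n := size s => n_ge2 sorted_hs perm_hs alt_h.
(* For even [n - i] the sign condition makes [f i] a lower bound of the constant, for odd [n - i] an
   upper bound; [L] and [U] collect them. *)
pose f i := - P.[s`_i]; pose e i := ~~ odd (n - i).
pose L := [seq f i | i <- iota 0 n & e i].
pose U := [seq f i | i <- iota 0 n & ~~ e i].
have altP c : alternates (P + c%:P) s <-> all (<= c) L /\ all (>= c) U.
  rewrite /L /U !all_map !all_filter; split=> [alt_c|[/allP Lc /allP Uc] i lt_i].
    split; apply/allP => i; rewrite mem_iota /= => /alt_c;
    rewrite /e /f hornerD hornerC -/n -signr_odd; case: odd => //=;
    rewrite ?expr1 ?expr0 ?mul1r ?mulN1r ?opprD ?subr_ge0 //.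
    by rewrite -lerBlDl sub0r.
  have i_n : i \in iota 0 n by rewrite mem_iota.
  have /implyP := Lc i i_n; have /implyP := Uc i i_n.
  rewrite /e /f hornerD hornerC -/n -signr_odd; case: odd => /=.
    by move=> /(_ isT) Ci _; rewrite expr1 mulN1r opprD subr_ge0.
  by move=> _ /(_ isT) Ci; rewrite expr0 mul1r -lerBlDl sub0r.
have sz_L : size L = n./2 by rewrite size_map size_filter (count_iota_even_sub 0).
have sz_U : size U = uphalf n.
  have : (size L + size U)%N = n.
    by rewrite !size_map !size_filter count_predC size_iota.
  rewrite sz_L uphalf_half -{2}(odd_double_half n) -addnn addnCA.
  exact: addnI.
have [/allP Lh /allP Uh] := (altP h).1 alt_h.
(* As [h] separates [L] from [U], sorting each block sorts the whole. *)
have Dhs : hs = sort <=%R L ++ sort <=%R U.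
  apply: le_sorted_eq => //.
    rewrite sorted_pairwise; last exact: le_trans.
    rewrite pairwise_cat -!sorted_pairwise ?sort_le_sorted ?andbT; try exact: le_trans.
    apply/allrelP => x y; rewrite !mem_sort => /Lh /= le_xh /Uh /=.
    exact: le_trans.
  have perm_LU : perm_eq (L ++ U) [seq f i | i <- iota 0 n].
    by rewrite -map_cat perm_map // perm_filterC.
  rewrite (perm_trans perm_hs) // perm_sym -{1}[s](mkseq_nth 0) -map_comp.
  by rewrite -(permPr perm_LU) perm_cat ?perm_sort.
(* Both blocks are nonempty, so the predecessor in the index of the last entry of [L] is not
   truncated. *)
have k_gt0 : (0 < n./2)%N by rewrite half_gt0.
apply: (iff_trans (altP C)); rewrite Dhs -{1}sz_L -all_le_sort_nth ?sz_L //.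
rewrite -sz_L -[size L](size_sort <=%R) -all_ge_sort_nth ?sz_U.
  by split=> /andP.
by rewrite uphalf_half addn_gt0 k_gt0 orbT.
Qed.

Theorem theorem2p6 (R : realType) (n : nat) (p : {poly R}) (mu : seq R)
    (hs : seq R) (h C : R) :
  (2 <= n)%N ->
  size p = n.+1 ->
  0 < lead_coef p ->
  real_rooted p ->
  (* mu lists the roots of p with multiplicity *)
  p = lead_coef p *: \prod_(m <- mu) ('X - m%:P) ->
  (* hs = (h_1 <= ... <= h_n) is the sorted multiset {-P(mu_i)} *)
  sorted <=%R hs ->
  perm_eq hs [seq - (prim p).[m] | m <- mu] ->
  (* h_k <= h <= h_(k+1) with k = floor(n/2), 1-indexed *)
  hs`_(n./2).-1 <= h <= hs`_(n./2) ->
  real_rooted (prim p + h%:P) ->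
  real_rooted (prim p + C%:P) <-> hs`_(n./2).-1 <= C <= hs`_(n./2).

Proof.
move=> n_ge2 sz_p lcp _ Dp sorted_hs perm_hs _ rooted_h.
have p_neq0 : p != 0 by rewrite -lead_coef_eq0 gt_eqF.
(* The order of [mu] is arbitrary, while the sign criterion reads the roots in increasing order. *)
have perm_s : perm_eq mu (sort <=%R mu) by rewrite perm_sym perm_sort.
set s := sort _ _ in perm_s.
have sorted_s : sorted <=%R s by apply: sort_le_sorted.
have sz_s : size s = n.
  have [] : (size mu).+1 = n.+1 by rewrite -sz_p Dp size_scale ?lead_coef_eq0 // size_prod_XsubC.
  by rewrite size_sort.
rewrite (perm_big _ perm_s) /= in Dp.
have alt_h := (real_rooted_prim p s h p_neq0 lcp sorted_s Dp).1 rooted_h.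
apply: (iff_trans (real_rooted_prim p s C p_neq0 lcp sorted_s Dp)).
rewrite -sz_s; apply: (alternates_sorted_values _ _ _ h); rewrite ?sz_s //.
by rewrite (perm_trans perm_hs) // perm_map.
Qed.
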